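(* Let $\omega:[1,\infty)\to\mathbb{R}$ be the Buchstab function. Let $N\ge 0$ be an integer, and let $T_2$ be the Taylor polynomial of degree $N$ of the function $u\mapsto\frac{\log(u-1)+1}{u}$ about the point $u=5/2$. For $j\ge 2$ define $T_{j+1}$ on $[j+1,j+2]$ from $T_j$ on $[j,j+1]$ by $$T_{j+1}(u)=\frac1u\left(\int_j^{u-1}T_j(t)\,dt+(j+1)\,T_j(j+1)\right),\qquad j+1\le u\le j+2 .$$ Then $$\max_{2\le u\le 3}|\omega(u)-T_2(u)|\le \frac{1}{3^{N+1}},$$ and the same error bound holds on every later interval: for every integer $j\ge 2$, $$\max_{j\le u\le j+1}|\omega(u)-T_j(u)|\le\frac{1}{3^{N+1}} .$$
   Context: The Buchstab function $\omega:[1,\infty)\to\mathbb{R}$ is the continuous function determined by the delay differential equation $\omega(u)=1/u$ for $1\le u\le 2$ and $(u\,\omega(u))'=\omega(u-1)$ for $u\ge 2$ (the derivative at $u=2$ being understood as one-sided from the right). In particular $\omega(u)=\frac{\log(u-1)+1}{u}$ for $2\le u\le 3$, and for every integer $j\ge 1$ one has $u\,\omega(u)=\int_j^{u-1}\omega(t)\,dt+(j+1)\,\omega(j+1)$ for $j+1\le u\le j+2$. Here $\log$ is the natural logarithm. *)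

(* Defs.v *)
From Stdlib Require Import Reals Factorial.
From Coquelicot Require Import Coquelicot.
Open Scope R_scope.

Definition is_right_derive (f : R -> R) (x l : R) : Prop :=
  filterlim (fun h => (f (x + h) - f x) / h) (at_right 0) (locally l).

(* The function lives on [1, +oo): no condition constrains its values on
   (-oo, 1), and continuity is that of the restriction to [1, +oo). *)
Definition is_buchstab (omega : R -> R) : Prop :=
  continuous_on (fun u => 1 <= u) omega /\
  (forall u, 1 <= u <= 2 -> omega u = 1 / u) /\
  is_right_derive (fun u => u * omega u) 2 (omega (2 - 1)) /\
  (forall u, 2 < u -> is_derive (fun v => v * omega v) u (omega (u - 1))).

Definition taylor_poly (f : R -> R) (a : R) (N : nat) (u : R) : R :=
  sum_f_R0 (fun n => Derive_n f n a / INR (fact n) * (u - a) ^ n) N.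

(* [buchstab_approx N j] is the approximation T_j on [j, j + 1], for j >= 2;
   the values at j = 0, 1 and outside [j, j + 1] carry no meaning. *)
Fixpoint buchstab_approx (N j : nat) : R -> R :=
  match j with
  | S (S (S _) as i) => fun u =>
      1 / u * (RInt (buchstab_approx N i) (INR i) (u - 1)
               + (INR i + 1) * buchstab_approx N i (INR i + 1))
  | _ => taylor_poly (fun u => (ln (u - 1) + 1) / u) (5 / 2) N
  end.

Definition is_max_on (f : R -> R) (a b M : R) : Prop :=
  (exists u, a <= u <= b /\ f u = M) /\ (forall u, a <= u <= b -> f u <= M).

(* Main.v *)
Require Import Defs.
From Stdlib Require Import Reals Factorial.
From Coquelicot Require Import Coquelicot.
From Stdlib Require Import Lra Lia.
Open Scope R_scope.

(** On [2, 3] the Buchstab function is f(u) = (ln(u-1) + 1) / u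
    ([buchstab_2_3]), so the first claim is a Taylor remainder estimate.  The
    nearest singularity of f is at distance 3/2 from the centre a = 5/2 and
    |u - a| <= 1/2, whence the ratio 1/3.  The constant 1 comes from clearing
    the denominator: if T is the Taylor polynomial of f of degree N and c_N
    its last coefficient, then u T(u) is the Taylor polynomial of
    ln(u-1) + 1 plus c_N (u-a)^(N+1) ([mul_taylor_quot]), so

      u (f(u) - T(u)) = (remainder of the logarithm) - c_N (u-a)^(N+1).

    The remainder of the logarithm has a derivative in closed form, because
    1/(u-1) minus a geometric partial sum is a single term; the mean value
    theorem bounds it by (1/2) 3^(-N) ([logrem_bound]).  The coefficients c_n
    satisfy a first-order recursion which for N >= 1 makes the other term at
    most (1/6) 3^(-N) ([quotcoef_bound]).  The sum is (2/3) 3^(-N), and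
    division by u >= 2 gives exactly 3^(-(N+1)).  For N = 0 the coefficient
    c_0 = f(a) is too large for this, but there f takes its values in an
    interval of length 1/3 ([quot_range]).

    A bound E for the error on [j, j+1] persists on [j+1, j+2]: omega obeys
    the same integral recursion as the approximations ([buchstab_integral]),
    so u times the new error is the integral of the old error over [j, u-1]
    plus (j+1) times its value at j+1, which is at most
    (u-1-j) E + (j+1) E = u E. *)

(** * The Taylor expansion of the quotient *)

Definition quot (u : R) : R := (ln (u - 1) + 1) / u.

(** The n-th derivative of ln(u-1) + 1 for u > 1. *)
Definition dlog (n : nat) (u : R) : R :=
  match n with
  | O => ln (u - 1) + 1
  | S k => (-1) ^ k * INR (fact k) / (u - 1) ^ S k
  end.

(** The n-th derivative of [quot] for u > 1, obtained by solving Leibniz's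
    rule (u f)^(n+1) = u f^(n+1) + (n+1) f^(n) for the top derivative. *)
Fixpoint dquot (n : nat) (u : R) : R :=
  match n with
  | O => dlog 0 u / u
  | S k => (dlog (S k) u - INR (S k) * dquot k u) / u
  end.

Lemma is_derive_dlog (n : nat) (u : R) :
  1 < u -> is_derive (dlog n) u (dlog (S n) u).
Proof.
  intros hu. destruct n as [|k]; unfold dlog.
  - auto_derive; [lra|]. simpl. field. lra.
  - assert (hp : (u - 1) ^ k <> 0) by (apply pow_nonzero; lra).
    auto_derive.
    + apply Rmult_integral_contrapositive_currified; [lra|exact hp].
    + change (match k with O => 1 | S _ => INR k + 1 end) with (INR (S k)).
      rewrite fact_simpl, mult_INR, <- !tech_pow_Rmult.
      replace (u + -(1)) with (u - 1) by ring. field. split; [exact hp|lra].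
Qed.

Lemma is_derive_dquot (n : nat) (u : R) :
  1 < u -> is_derive (dquot n) u (dquot (S n) u).
Proof.
  revert u. induction n as [|k IH]; intros u hu.
  - pose proof (is_derive_dlog 0 u hu) as hd.
    evar_last.
    + apply (is_derive_div (dlog 0) (fun v => v) u _ 1 hd (is_derive_id u)).
      lra.
    + simpl. field. lra.
  - pose proof (is_derive_dlog (S k) u hu) as hd.
    evar_last.
    + apply (is_derive_div
               (fun v => dlog (S k) v - INR (S k) * dquot k v) (fun v => v) u
               (dlog (S (S k)) u - INR (S k) * dquot (S k) u) 1).
      * apply (is_derive_minus (dlog (S k)) (fun v => INR (S k) * dquot k v)).
        -- exact hd.
        -- apply is_derive_scal. exact (IH u hu).
      * exact (is_derive_id u).
      * lra.
    + change (dquot (S (S k)) u)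
        with ((dlog (S (S k)) u - INR (S (S k)) * dquot (S k) u) / u).
      change (dquot (S k) u) with ((dlog (S k) u - INR (S k) * dquot k u) / u).
      rewrite (S_INR (S k)). field. lra.
Qed.

Lemma Derive_n_quot (n : nat) (u : R) :
  1 < u -> Derive_n quot n u = dquot n u.
Proof.
  revert u. induction n as [|k IH]; intros u hu; [reflexivity|].
  simpl Derive_n. rewrite (Derive_ext_loc _ (dquot k)).
  - apply is_derive_unique, is_derive_dquot, hu.
  - apply (filter_imp (fun v => 1 < v)); [exact IH|].
    exact (open_gt 1 u hu).
Qed.

Definition logcoef (n : nat) : R := dlog n (5 / 2) / INR (fact n).

Definition quotcoef (n : nat) : R := dquot n (5 / 2) / INR (fact n).

Lemma taylor_quot (N : nat) (u : R) :
  taylor_poly quot (5 / 2) N u =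
  sum_f_R0 (fun n => quotcoef n * (u - 5 / 2) ^ n) N.
Proof.
  unfold taylor_poly, quotcoef. apply sum_eq. intros n _.
  rewrite Derive_n_quot by lra. reflexivity.
Qed.

(** Compare the coefficients of (u-a)^(n+1) in u f(u) = ln(u-1) + 1, writing
    u = a + (u-a). *)
Lemma quotcoef_succ (n : nat) :
  5 / 2 * quotcoef (S n) + quotcoef n = logcoef (S n).
Proof.
  unfold quotcoef, logcoef.
  change (dquot (S n) (5 / 2)) with
    ((dlog (S n) (5 / 2) - INR (S n) * dquot n (5 / 2)) / (5 / 2)).
  rewrite fact_simpl, mult_INR. field.
  split; [apply INR_fact_neq_0|apply not_0_INR; lia].
Qed.

Lemma logcoef_succ (n : nat) :
  INR (S n) * logcoef (S n) = (-1) ^ n * (2 / 3) ^ S n.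
Proof.
  unfold logcoef, dlog. replace (5 / 2 - 1) with (3 / 2) by lra.
  rewrite fact_simpl, mult_INR.
  replace (2 / 3) with (/ (3 / 2)) by field. rewrite pow_inv.
  field. repeat split;
    [apply pow_nonzero; lra|apply INR_fact_neq_0|apply not_0_INR; lia].
Qed.

(** All the terms of the product agree with those of the logarithm except the
    top one, which the expansion of the logarithm has not yet reached. *)
Lemma mul_taylor_quot (N : nat) (u : R) :
  u * sum_f_R0 (fun n => quotcoef n * (u - 5 / 2) ^ n) N =
  sum_f_R0 (fun n => logcoef n * (u - 5 / 2) ^ n) N
  + quotcoef N * (u - 5 / 2) ^ S N.
Proof.
  induction N as [|N IH].
  - unfold quotcoef, logcoef. simpl. field.
  - rewrite !tech5, Rmult_plus_distr_l, IH, <- quotcoef_succ.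
    rewrite <- !tech_pow_Rmult. ring.
Qed.

Definition logrem (N : nat) (u : R) : R :=
  dlog 0 u - sum_f_R0 (fun n => logcoef n * (u - 5 / 2) ^ n) N.

(** With q = -(2/3)(u-a) one has (2/3)(u-1) = 1 - q, and subtracting from
    1/(u-1) the terms (2/3) q^n with n < N of the geometric series leaves
    q^N / (u-1). *)
Lemma is_derive_logrem (N : nat) (u : R) :
  1 < u ->
  is_derive (logrem N) u ((- (2 / 3) * (u - 5 / 2)) ^ N / (u - 1)).
Proof.
  intros hu. induction N as [|N IH].
  - unfold logrem, dlog. simpl. auto_derive; [lra|]. field. lra.
  - apply (is_derive_ext
             (fun v => logrem N v - logcoef (S N) * (v - 5 / 2) ^ S N)).
    { intros v. unfold logrem. rewrite tech5. simpl. ring. }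
    evar_last.
    + apply (is_derive_minus (logrem N)); [exact IH|].
      apply (is_derive_scal (fun v => (v - 5 / 2) ^ S N)).
      apply (is_derive_pow (fun v => v - 5 / 2) (S N) u 1).
      auto_derive; [exact I|ring].
    + unfold minus, plus, opp; simpl Hierarchy.plus. simpl pred.
      replace (logcoef (S N) * (INR (S N) * 1 * (u - 5 / 2) ^ N))
        with (INR (S N) * logcoef (S N) * (u - 5 / 2) ^ N) by ring.
      rewrite logcoef_succ.
      rewrite <- !tech_pow_Rmult, !Rpow_mult_distr.
      replace (- (2 / 3)) with (-1 * (2 / 3)) by ring.
      rewrite !Rpow_mult_distr. simpl. field. lra.
Qed.

Lemma logrem_center (N : nat) : logrem N (5 / 2) = 0.
Proof.
  unfold logrem. replace (5 / 2 - 5 / 2) with 0 by ring.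
  induction N as [|N IH].
  - unfold logcoef. simpl. field.
  - rewrite tech5, pow_i by lia. rewrite Rmult_0_r, Rplus_0_r. exact IH.
Qed.

(** On [2, 3] the geometric ratio is at most 1/3 in absolute value, the
    denominator u - 1 is at least 1, and the distance to the centre is at most
    1/2. *)
Lemma logrem_bound (N : nat) (u : R) :
  2 <= u <= 3 -> Rabs (logrem N u) <= 1 / 2 * (1 / 3) ^ N.
Proof.
  intros hu.
  destruct (MVT_gen (logrem N) (5 / 2) u
              (fun v => (- (2 / 3) * (v - 5 / 2)) ^ N / (v - 1)))
    as [c [hc he]].
  - intros v hv. apply is_derive_logrem.
    revert hv. unfold Rmin, Rmax. destruct Rle_dec; lra.
  - intros v hv. apply derivable_continuous_pt, ex_derive_Reals_0.
    eexists. apply is_derive_logrem.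
    revert hv. unfold Rmin, Rmax. destruct Rle_dec; lra.
  - assert (hc' : 2 <= c <= 3)
      by (revert hc; unfold Rmin, Rmax; destruct Rle_dec; lra).
    rewrite logrem_center, Rminus_0_r in he. rewrite he.
    rewrite Rabs_mult, (Rmult_comm (1 / 2)).
    apply Rmult_le_compat; try apply Rabs_pos; [|apply Rabs_le; lra].
    unfold Rdiv at 1. rewrite Rabs_mult, <- RPow_abs.
    rewrite <- (Rmult_1_r ((1 / 3) ^ N)).
    apply Rmult_le_compat; try apply Rabs_pos; [apply pow_le, Rabs_pos| |].
    + apply pow_incr. split; [apply Rabs_pos|apply Rabs_le; lra].
    + rewrite Rabs_pos_eq.
      * rewrite <- Rinv_1. apply Rinv_le_contravar; lra.
      * left. apply Rinv_0_lt_compat. lra.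
Qed.

Lemma ln_bounds (x : R) : 0 < x -> 1 - 1 / x <= ln x <= x - 1.
Proof.
  intros hx. split.
  - assert (h := exp_ineq1_le (- ln x)).
    rewrite exp_Ropp, exp_ln in h by exact hx.
    unfold Rdiv. lra.
  - assert (h := exp_ineq1_le (ln x)). rewrite exp_ln in h by exact hx. lra.
Qed.

(** Normalised as e_n = (5/2) (3/2)^n c_n, the coefficients satisfy
    e_(n+1) = (-1)^n / (n+1) - (3/5) e_n.  Once n >= 2 the forcing term is at
    most 1/3, and 5/6 is the fixed point of x = 1/3 + (3/5) x.  Since
    e_0 = ln(3/2) + 1 exceeds 5/6 and the early forcing terms are larger, e_1
    and e_2 are first located by keeping track of signs. *)
Lemma quotcoef_bound (N : nat) :
  (1 <= N)%nat -> Rabs (5 / 2 * (3 / 2) ^ N * quotcoef N) <= 5 / 6.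
Proof.
  set (e := fun n => 5 / 2 * (3 / 2) ^ n * quotcoef n).
  assert (he : forall n, e (S n) = (-1) ^ n / INR (S n) - 3 / 5 * e n).
  { intros n. unfold e.
    replace (5 / 2 * (3 / 2) ^ S n * quotcoef (S n))
      with ((3 / 2) ^ S n * (5 / 2 * quotcoef (S n) + quotcoef n)
            - (3 / 2) ^ S n * quotcoef n) by ring.
    rewrite quotcoef_succ.
    assert (hn : INR (S n) <> 0) by (apply not_0_INR; lia).
    replace (logcoef (S n))
      with ((-1) ^ n * (2 / 3) ^ S n / INR (S n))
      by (rewrite <- logcoef_succ; field; exact hn).
    replace ((3 / 2) ^ S n * ((-1) ^ n * (2 / 3) ^ S n / INR (S n)))
      with ((3 / 2) ^ S n * (2 / 3) ^ S n * ((-1) ^ n / INR (S n)))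
      by (field; exact hn).
    rewrite <- Rpow_mult_distr. replace (3 / 2 * (2 / 3)) with 1 by field.
    rewrite pow1. simpl pow. field. exact hn. }
  assert (h0 : 1 <= e 0%nat <= 3 / 2).
  { unfold e, quotcoef, dquot, dlog. simpl.
    assert (h := ln_bounds (5 / 2 - 1) ltac:(lra)).
    replace (1 / (5 / 2 - 1)) with (2 / 3) in h by field.
    lra. }
  assert (h1 : 1 / 10 <= e 1%nat <= 2 / 5).
  { rewrite he. simpl. lra. }
  assert (h2 : Rabs (e 2%nat) <= 5 / 6).
  { rewrite he. simpl. apply Rabs_le. lra. }
  intros hN. destruct N as [|[|n]]; [lia| |].
  - fold (e 1%nat). apply Rabs_le. lra.
  - clear hN. fold (e (S (S n))). induction n as [|n IH]; [exact h2|].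
    rewrite he. unfold Rminus.
    eapply Rle_trans; [apply Rabs_triang|].
    rewrite Rabs_Ropp, Rabs_mult, (Rabs_pos_eq (3 / 5)) by lra.
    unfold Rdiv at 1. rewrite Rabs_mult, pow_1_abs, Rmult_1_l.
    assert (h3 : 3 <= INR (S (S (S n)))).
    { rewrite !S_INR. pose proof (pos_INR n). lra. }
    assert (h4 : Rabs (/ INR (S (S (S n)))) <= / 3).
    { rewrite Rabs_pos_eq.
      - apply Rinv_le_contravar; lra.
      - left. apply Rinv_0_lt_compat. lra. }
    lra.
Qed.

Lemma quot_range (u : R) : 2 <= u <= 3 -> 1 / 3 <= quot u <= 2 / 3.
Proof.
  intros hu. unfold quot. assert (h := ln_bounds (u - 1) ltac:(lra)).
  assert (h' : 0 <= ln (u - 1)) by (rewrite <- ln_1; apply ln_le; lra).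
  assert (he : (ln (u - 1) + 1) / u * u = ln (u - 1) + 1) by (field; lra).
  split; apply (Rmult_le_reg_r u); lra.
Qed.

Lemma quot_taylor_error (N : nat) (u : R) :
  2 <= u <= 3 ->
  Rabs (quot u - taylor_poly quot (5 / 2) N u)
  <= 1 / 3 ^ (N + 1).
Proof.
  intros hu. destruct N as [|n].
  - unfold taylor_poly. simpl. fold (quot (5 / 2)).
    assert (h := quot_range u hu).
    assert (h' := quot_range (5 / 2) ltac:(lra)).
    apply Rabs_le. lra.
  - rewrite taylor_quot. set (N := S n).
    assert (hid : u * (quot u
                    - sum_f_R0 (fun k => quotcoef k * (u - 5 / 2) ^ k) N)
                  = logrem N u - quotcoef N * (u - 5 / 2) ^ S N).
    { rewrite Rmult_minus_distr_l, mul_taylor_quot.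
      unfold logrem, quot, dlog. field. lra. }
    assert (hl := logrem_bound N u hu).
    assert (hq := quotcoef_bound N ltac:(unfold N; lia)).
    assert (h3 : 0 < (1 / 3) ^ N) by (apply pow_lt; lra).
    assert (hr : Rabs (quotcoef N * (u - 5 / 2) ^ S N)
                 <= 1 / 6 * (1 / 3) ^ N).
    { (* (5/2)(3/2)^N c_N is the normalised coefficient, so c_N carries the
         factor (2/5)(2/3)^N, and (2/3)(1/2) = 1/3. *)
      replace (1 / 6 * (1 / 3) ^ N)
        with (5 / 6 * (2 / 5 * (2 / 3) ^ N * (1 / 2) ^ S N)).
      - replace (quotcoef N * (u - 5 / 2) ^ S N)
          with (5 / 2 * (3 / 2) ^ N * quotcoef N
                * (2 / 5 * (2 / 3) ^ N * (u - 5 / 2) ^ S N)).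
        + rewrite Rabs_mult.
          apply Rmult_le_compat; try apply Rabs_pos; [exact hq|].
          rewrite Rabs_mult, (Rabs_pos_eq (2 / 5 * _)).
          * apply Rmult_le_compat_l.
            -- apply Rmult_le_pos; [lra|apply pow_le; lra].
            -- rewrite <- RPow_abs. apply pow_incr.
               split; [apply Rabs_pos|apply Rabs_le; lra].
          * apply Rmult_le_pos; [lra|apply pow_le; lra].
        + transitivity ((3 / 2 * (2 / 3)) ^ N
                        * (quotcoef N * (u - 5 / 2) ^ S N)).
          * rewrite Rpow_mult_distr. field.
          * replace (3 / 2 * (2 / 3)) with 1 by field. rewrite pow1. ring.
      - replace (1 / 3) with (2 / 3 * (1 / 2)) by field.
        rewrite Rpow_mult_distr. simpl pow. field. }
    set (d := quot u - _) in *.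
    replace (1 / 3 ^ (N + 1)) with (1 / 3 * (1 / 3) ^ N).
    2:{ rewrite Nat.add_1_r. unfold Rdiv at 2. rewrite Rmult_1_l, pow_inv.
        simpl pow. field. apply pow_nonzero. lra. }
    assert (hb : u * Rabs d <= 2 / 3 * (1 / 3) ^ N).
    { rewrite <- (Rabs_pos_eq u) at 1 by lra. rewrite <- Rabs_mult, hid.
      eapply Rle_trans; [apply (Rabs_triang _ (- _))|].
      rewrite Rabs_Ropp. lra. }
    pose proof (Rabs_pos d). nra.
Qed.

(** * The Buchstab function *)

Lemma buchstab_continuous (omega : R -> R) (homega : is_buchstab omega)
    (u : R) :
  1 < u -> continuous omega u.
Proof.
  intros hu. destruct homega as [hc _].
  apply (continuous_continuous_on (fun v => 1 <= v)); [|exact hc].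
  apply (filter_imp (fun v => 1 < v)); [intros; lra|exact (open_gt 1 u hu)].
Qed.

(** The function v omega(v) - ln(v-1) has zero derivative inside [2, 3], is
    continuous there and equals 1 at v = 2. *)
Lemma buchstab_2_3 (omega : R -> R) (homega : is_buchstab omega) (u : R) :
  2 <= u <= 3 -> omega u = quot u.
Proof.
  intros hu.
  pose proof (buchstab_continuous omega homega) as hc.
  destruct homega as [_ [h12 [_ hd]]].
  destruct (MVT_gen (fun v => v * omega v - ln (v - 1)) 2 u
              (fun v => omega (v - 1) - 1 / (v - 1))) as [c [hcu he]].
  - intros v hv. rewrite Rmin_left, Rmax_right in hv by lra.
    apply (is_derive_minus (fun v => v * omega v)); [apply hd; lra|].
    auto_derive; [lra|]. field. lra.
  - intros v hv. rewrite Rmin_left, Rmax_right in hv by lra.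
    apply continuity_pt_filterlim.
    apply (continuous_minus (fun v => v * omega v) (fun v => ln (v - 1))).
    + apply (continuous_mult (fun v => v) omega);
        [apply continuous_id|apply hc; lra].
    + apply (ex_derive_continuous (V := R_NormedModule)). auto_derive. lra.
  - rewrite Rmin_left, Rmax_right in hcu by lra.
    rewrite (h12 (c - 1)) in he by lra.
    rewrite (h12 2) in he by lra.
    replace (2 - 1) with 1 in he by ring. rewrite ln_1 in he.
    apply (Rmult_eq_reg_l u); [|lra].
    transitivity (ln (u - 1) + 1); [lra|unfold quot; field; lra].
Qed.

Lemma buchstab_integral (omega : R -> R) (homega : is_buchstab omega)
    (a u : R) :
  2 < a <= u -> u * omega u = RInt omega (a - 1) (u - 1) + a * omega a.
Proof.
  intros hau.
  pose proof (buchstab_continuous omega homega) as hc.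
  destruct homega as [_ [_ [_ hd]]].
  assert (h : is_RInt (fun v => omega (v - 1)) a u
                (minus (u * omega u) (a * omega a))).
  { apply (is_RInt_derive (fun v => v * omega v)).
    - intros v hv. rewrite Rmin_left in hv by lra. apply hd. lra.
    - intros v hv. rewrite Rmin_left in hv by lra.
      apply (continuous_comp (fun v => v - 1) omega).
      + apply (ex_derive_continuous (V := R_NormedModule)).
        auto_derive. exact I.
      + apply hc. lra. }
  apply (is_RInt_unique (V := R_CompleteNormedModule)) in h.
  assert (hs := RInt_comp_lin (V := R_CompleteNormedModule) omega 1 (-1) a u).
  replace (1 * a + -1) with (a - 1) in hs by ring.
  replace (1 * u + -1) with (u - 1) in hs by ring.
  rewrite <- hs.
  - rewrite (RInt_ext _ (fun v => omega (v - 1))).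
    + rewrite h. unfold minus, plus, opp; simpl. ring.
    + intros v _. replace (1 * v + -1) with (v - 1) by ring.
      apply (scal_one (V := R_ModuleSpace)).
  - apply (ex_RInt_continuous (V := R_CompleteNormedModule) omega).
    intros v hv. rewrite Rmin_left in hv by lra. apply hc. lra.
Qed.

(** * Propagation of the error *)

Lemma buchstab_approx_succ (N j : nat) (u : R) :
  (2 <= j)%nat ->
  buchstab_approx N (S j) u =
  1 / u * (RInt (buchstab_approx N j) (INR j) (u - 1)
           + (INR j + 1) * buchstab_approx N j (INR j + 1)).
Proof. intros hj. destruct j as [|[|j]]; [lia|lia|reflexivity]. Qed.

(** The integral in the recursion needs the previous approximation at u - 1
    only, so the domain of continuity moves up by at most 1 at each step and
    always contains a neighbourhood of [j, j+1]. *)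
Lemma buchstab_approx_continuous (N j : nat) :
  (2 <= j)%nat ->
  forall u, INR j - 2 < u -> continuous (buchstab_approx N j) u.
Proof.
  induction 1 as [|j hj IH]; intros u hu.
  - apply (continuous_ext
             (fun v => sum_f_R0 (fun n => quotcoef n * (v - 5 / 2) ^ n) N)).
    { intros v. symmetry. apply taylor_quot. }
    clear hu. apply (ex_derive_continuous (V := R_NormedModule)).
    induction N as [|N IH].
    + simpl. auto_derive. exact I.
    + simpl sum_f_R0. apply (ex_derive_plus (V := R_NormedModule));
        [exact IH|]. auto_derive. exact I.
  - rewrite S_INR in hu.
    assert (hj2 : 2 <= INR j) by (apply (le_INR 2); exact hj).
    apply (continuous_ext (fun v => 1 / v *
      (RInt (buchstab_approx N j) (INR j) (v - 1)
       + (INR j + 1) * buchstab_approx N j (INR j + 1)))).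
    { intros v. symmetry. apply buchstab_approx_succ, hj. }
    apply (continuous_mult (fun v => 1 / v)).
    { apply (ex_derive_continuous (V := R_NormedModule)). auto_derive. lra. }
    apply (continuous_plus
             (fun v => RInt (buchstab_approx N j) (INR j) (v - 1)));
      [|apply continuous_const].
    apply (continuous_comp (fun v => v - 1)
             (RInt (buchstab_approx N j) (INR j))).
    { apply (ex_derive_continuous (V := R_NormedModule)).
      auto_derive. exact I. }
    apply (ex_derive_continuous (V := R_NormedModule)).
    exists (buchstab_approx N j (u - 1)).
    apply (is_derive_RInt _ _ (INR j)).
    + apply (filter_imp (fun v => INR j - 2 < v));
        [|apply (open_gt (INR j - 2) (u - 1)); simpl; lra].
      intros v hv. apply (RInt_correct (V := R_CompleteNormedModule)).
      apply (ex_RInt_continuous (V := R_CompleteNormedModule)).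
      intros w hw. apply IH. revert hw. unfold Rmin, Rmax.
      destruct Rle_dec; lra.
    + apply IH. lra.
Qed.

Lemma buchstab_approx_error (omega : R -> R) (homega : is_buchstab omega)
    (N j : nat) :
  (2 <= j)%nat ->
  forall u, INR j <= u <= INR j + 1 ->
  Rabs (omega u - buchstab_approx N j u) <= 1 / 3 ^ (N + 1).
Proof.
  induction 1 as [|j hj IH]; intros u hu.
  - simpl in hu. rewrite (buchstab_2_3 omega homega) by lra.
    apply quot_taylor_error. lra.
  - rewrite S_INR in hu.
    assert (hj2 : 2 <= INR j) by (apply (le_INR 2); exact hj).
    rewrite (buchstab_approx_succ N j u hj).
    set (T := buchstab_approx N j) in *. set (E := 1 / 3 ^ (N + 1)) in *.
    assert (hT : forall v, INR j - 2 < v -> continuous T v)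
      by exact (buchstab_approx_continuous N j hj).
    pose proof (buchstab_continuous omega homega) as hc.
    assert (hi := buchstab_integral omega homega (INR j + 1) u ltac:(lra)).
    replace (INR j + 1 - 1) with (INR j) in hi by ring.
    assert (ew : ex_RInt omega (INR j) (u - 1)).
    { apply (ex_RInt_continuous (V := R_CompleteNormedModule)).
      intros v hv. rewrite Rmin_left in hv by lra. apply hc. lra. }
    assert (eT : ex_RInt T (INR j) (u - 1)).
    { apply (ex_RInt_continuous (V := R_CompleteNormedModule)).
      intros v hv. rewrite Rmin_left in hv by lra. apply hT. lra. }
    assert (hm : RInt omega (INR j) (u - 1) - RInt T (INR j) (u - 1)
                 = RInt (fun v => omega v - T v) (INR j) (u - 1))
      by (symmetry; apply (RInt_minus omega T); assumption).
    assert (hI : Rabs (RInt (fun v => omega v - T v) (INR j) (u - 1))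
                 <= (u - 1 - INR j) * E).
    { apply abs_RInt_le_const; [lra| |].
      - apply (ex_RInt_minus omega T); assumption.
      - intros v hv. apply IH. lra. }
    assert (he := IH (INR j + 1) ltac:(lra)).
    set (J := RInt (fun v => omega v - T v) (INR j) (u - 1)) in *.
    set (e := omega (INR j + 1) - T (INR j + 1)) in *.
    assert (hd : u * (omega u - 1 / u * (RInt T (INR j) (u - 1)
                        + (INR j + 1) * T (INR j + 1)))
                 = J + (INR j + 1) * e).
    { rewrite <- hm. unfold e. rewrite Rmult_minus_distr_l, hi. field. lra. }
    apply (Rmult_le_reg_l u); [lra|].
    rewrite <- (Rabs_pos_eq u) at 1 by lra. rewrite <- Rabs_mult, hd.
    eapply Rle_trans; [apply Rabs_triang|].
    rewrite Rabs_mult, (Rabs_pos_eq (INR j + 1)) by lra.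
    assert ((INR j + 1) * Rabs e <= (INR j + 1) * E)
      by (apply Rmult_le_compat_l; lra).
    lra.
Qed.

Lemma max_le_of_continuous (f : R -> R) (a b B : R) :
  a <= b ->
  (forall u, a <= u <= b -> continuous f u) ->
  (forall u, a <= u <= b -> f u <= B) ->
  exists M, is_max_on f a b M /\ M <= B.
Proof.
  intros hab hf hB.
  destruct (continuity_ab_maj f a b hab) as [x [hx hxab]].
  { intros u hu. apply continuity_pt_filterlim. exact (hf u hu). }
  exists (f x). repeat split; [exists x; now split|exact hx|exact (hB x hxab)].
Qed.

Theorem mainTheorem2 (omega : R -> R) (homega : is_buchstab omega) (N : nat) :
  (exists M : R,
     is_max_on (fun u => Rabs (omega u - buchstab_approx N 2 u)) 2 3 M /\
     M <= 1 / 3 ^ (N + 1)) /\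
  (forall j : nat, (2 <= j)%nat ->
     exists M : R,
       is_max_on (fun u => Rabs (omega u - buchstab_approx N j u))
         (INR j) (INR j + 1) M /\
       M <= 1 / 3 ^ (N + 1)).
Proof.
  assert (h : forall j : nat, (2 <= j)%nat ->
     exists M : R,
       is_max_on (fun u => Rabs (omega u - buchstab_approx N j u))
         (INR j) (INR j + 1) M /\
       M <= 1 / 3 ^ (N + 1)).
  { intros j hj. apply max_le_of_continuous; [lra| |].
    - assert (hj2 : 2 <= INR j) by (apply (le_INR 2); exact hj).
      intros u hu. apply continuous_comp; [|apply continuous_Rabs].
      apply (continuous_minus omega (buchstab_approx N j)).
      + apply (buchstab_continuous omega homega). lra.
      + apply buchstab_approx_continuous; [exact hj|lra].
    - exact (buchstab_approx_error omega homega N j hj). }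
  split; [|exact h].
  assert (h2 := h 2%nat (le_n 2)).
  replace (INR 2) with 2 in h2 by (simpl; ring).
  replace (2 + 1) with 3 in h2 by ring. exact h2.
Qed.
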